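(* Take any $f\in\mathcal F_{1,2}\setminus\{0,\psi_\infty\}$. Let $s_f:=\inf\operatorname{supp}\gamma_f$. Then the following statements hold. (i) $s_f\in[0,\infty)$. (ii) For any $s\in(0,s_f]$, one has $L_{f;s}(x)=f(s)$ for all $x\in(0,s)$. (iii) For any $s\in(s_f,\infty)$, one has $L'_{f;s}(0+)>0$ and $L'_{f;s}(s-)<0$. (iv) For any $s\in(0,\infty)$, there is some (not necessarily unique) $x_{f;s}\in(0,s)$ such that $L_{f;s}(x)$ is nondecreasing in $x\in(0,x_{f;s}]$ and nonincreasing in $x\in[x_{f;s},s)$. (v) One has $$C_f=\sup_{s\in(s_f,\infty)}\Big[\tfrac1{f(s)}\max_{x\in(0,s)}L_{f;s}(x)\Big]=\sup_{s\in(s_f,\infty)}\Big[\tfrac1{f(s)}L_{f;s}(x_{f;s})\Big]>1.$$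
   Context: $\mathcal F_{1,2}$ is the class of all continuously differentiable functions $f:\mathbb R\to\mathbb R$ such that $f(0)=0$, $f$ is even, and $f'$ is nondecreasing and concave on $[0,\infty)$. On $(0,\infty)$, $f''$ denotes the right derivative of $f'$; on $(-\infty,0)$, $f''$ denotes the left derivative of $f'$. For $t\in(0,\infty)$ and real $x$, $\psi_t(x):=x^2-(\max(0,|x|-t))^2$, and $\psi_\infty(x):=x^2$. For $f\in\mathcal F_{1,2}$, $\gamma_f$ is the unique nonnegative Borel measure on $(0,\infty]$ such that $\int_{(0,\infty]}\min(t,1)\,\gamma_f(dt)<\infty$ and $f(x)=\int_{(0,\infty]}\psi_t(x)\,\gamma_f(dt)$ for all real $x$; it is determined by the condition $\gamma_f((x,\infty])=\frac12f''(x)$ for all $x\in(0,\infty)$. $\operatorname{supp}\gamma_f\subseteq(0,\infty]$ is its support. For $s\in(0,\infty)$, $L_{f;s}(x):=f(x-s)-f(x)+sf'(x)$, and $C_f:=\sup_{0<x<s<\infty}L_{f;s}(x)/f(s)$ for $f\ne0$. $L'_{f;s}$ is the derivative of $L_{f;s}$ in $x$, i.e. $L'_{f;s}(x)=f'(x-s)-f'(x)+sf''(x)$, and $L'_{f;s}(0+)$, $L'_{f;s}(s-)$ are its right limit at $0$ (possibly $+\infty$) and left limit at $s$.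
   Formalization: The formal statement excludes 0 and all positive multiples cψ_∞, not just ψ_∞: for f = 2ψ_∞ one has γ_f = 2δ_∞, s_f = ∞ and C_f = 1, so (i) and (v) fail as written. *)

(* Defs.v *)
From HB Require Import structures.
From mathcomp Require Import all_boot all_order all_algebra.
From mathcomp Require Import all_classical all_reals all_analysis.
From mathcomp Require Import measurable_realfun.

Set Implicit Arguments.
Unset Strict Implicit.
Unset Printing Implicit Defensive.

Import Order.TTheory GRing.Theory Num.Theory.
Import numFieldNormedType.Exports.

Local Open Scope classical_set_scope.
Local Open Scope ring_scope.

Section definitions.
Context {R : realType}.
Implicit Types (f : R -> R) (s x : R) (t : \bar R).

Definition F12 f : Prop :=
  [/\ (forall x, derivable f x 1) /\ continuous (derive1 f),
      f 0 = 0,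
      forall x, f (- x) = f x,
      {in `[0, +oo[ &, {homo derive1 f : x y / x <= y}} &
      convex_function (`[0, +oo[%classic : set R) (\- derive1 f)].

(* The value at 0 is a placeholder: the second derivative is only used off 0. *)
Definition second_deriv f x : R :=
  if 0 < x then lim (h^-1 * (derive1 f (x + h) - derive1 f x) @[h --> 0^'+])
  else if x < 0 then lim (h^-1 * (derive1 f (x + h) - derive1 f x) @[h --> 0^'-])
  else 0.

(* Only 0 < t <= +oo is meaningful; the value at -oo is a placeholder. *)
Definition psi t x : R :=
  match t with
  | r%:E => x ^+ 2 - (Num.max 0 (`|x| - r)) ^+ 2
  | +oo%E => x ^+ 2
  | -oo%E => 0
  end.

(* A Borel measure on ]0, +oo] is encoded as a Borel measure on \bar R that
   vanishes outside ]0, +oo]. *)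
Definition represents f (g : {measure set (\bar R) -> \bar R}) : Prop :=
  [/\ g (~` `]0%E, +oo%E]) = 0%E,
      (\int[g]_(t in `]0%E, +oo%E]) mine t 1 < +oo)%E &
      forall x, ((f x)%:E = \int[g]_(t in `]0%E, +oo%E]) (psi t x)%:E)%E].

(* The definite description "the measure g such that represents f g"; mzero is
   the junk value returned when there is none. *)
Definition gamma f : {measure set (\bar R) -> \bar R} :=
  xget (mzero : {classic {measure set (\bar R) -> \bar R}}) (represents f).

Definition supp (g : {measure set (\bar R) -> \bar R}) : set (\bar R) :=
  [set t | (0 < t)%E /\
    forall U : set (\bar R), open U -> U t -> (0 < g (U `&` `]0%E, +oo%E]))%E].

Definition s_ f : \bar R := ereal_inf (supp (gamma f)).

Definition L f s x : R := f (x - s) - f x + s * derive1 f x.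

(* L f s need not be differentiable at the kinks of derive1 f: there this is its
   right derivative. Only 0 < x < s is used. *)
Definition L' f s x : R := derive1 f (x - s) - derive1 f x + s * second_deriv f x.

Definition C_ f : \bar R :=
  ereal_sup [set y | exists s x, 0 < x < s /\ y = (L f s x / f s)%:E].

Definition is_max (A : set R) (m : R) : Prop := A m /\ ubound A m.

Definition is_peak f s x : Prop :=
  [/\ 0 < x < s,
      {in `]0, x] &, {homo L f s : y z / y <= z}} &
      {in `[x, s[ &, {homo L f s : y z /~ y <= z}}].

End definitions.

(* Main.v *)
Require Import Defs.
From HB Require Import structures.
From mathcomp Require Import all_boot all_order all_algebra.
From mathcomp Require Import all_classical all_reals all_analysis.
From mathcomp Require Import measurable_realfun.
From mathcomp Require Import ring lra.

Set Implicit Arguments.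
Unset Strict Implicit.
Unset Printing Implicit Defensive.

Import Order.TTheory GRing.Theory Num.Theory.
Import numFieldNormedType.Exports.

Local Open Scope classical_set_scope.
Local Open Scope ring_scope.

(** Write phi for the derivative of f: it is odd, vanishes at 0, and on
    [0, +oo[ it is nondecreasing and concave.  The argument has two halves.

    The first half identifies s_f, which is defined through a measure, with an
    elementary quantity: for s > 0, s <= s_f iff phi is linear on [0, s]
    (le_s_iff_linear).  A representing measure must first be shown to exist
    (exists_representation): let T(u) be the generalised inverse of half the
    second derivative, i.e. the supremum of the x such that f''(x) > 2u, and push
    Lebesgue measure forward along T.  The mass possibly sitting at +oo and the
    mass possibly accumulating at 0 need no special treatment.  That this
    measure represents f is a double integration, done without a fundamental
    theorem of calculus: two functions whose increments on every [x, y] lie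
    between the same two bounds differ by a constant as soon as the gap between
    the bounds is (y - x) times the increment of a fixed function
    (constant_of_increment_le).  It is applied once to phi and
    the integral of min(T, x), then to f and the integral of psi_T(x).
    Conversely, for any representing measure, psi_t(x) / x^2 is constant in x on
    ]0, t] and drops strictly beyond t, so f is a multiple of x^2 on [0, s] iff
    ]0, s[ is a null set, iff the support does not meet ]0, s[.

    The second half is elementary.  If phi is linear on [0, s], then L is
    constant, equal to f(s), on ]0, s[.  In general L is concave on [0, s/2]
    (L_concave_left) and nonincreasing on [s/2, s] (L_nonincreasing_right), and
    L(x) - f(s) is at least (s - x) phi(x) - x phi(s - x) >= 0 for x <= s/2
    (L_ge_left).  Hence L has a peak, a maximiser of L on ]0, s/2].  When phi is
    not linear on [0, s] this lower bound is positive at some x, so that the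
    supremum of L / f(s) exceeds 1 and pairs (s, x) with s <= s_f, which give
    the value 1, do not contribute to C_f.  The signs of the two limits of L'
    come from comparing the second derivative near 0 and near s with the slope
    phi(s) / s of the chord of phi. *)

(** * Concave functions vanishing at the origin *)

(** Concavity on [0, +oo[, as the division-free comparison of the slopes of two
    adjacent chords: the form in which it is used everywhere below. *)
Definition concave_slopes (R : realType) (phi : R -> R) : Prop :=
  forall x y z, 0 <= x -> x < y -> y < z ->
  (phi z - phi y) * (y - x) <= (phi y - phi x) * (z - y).

Section concave.
Variables (R : realType) (phi : R -> R).
Hypothesis concave_phi : concave_slopes phi.
Hypothesis phi0 : phi 0 = 0.
Implicit Types x y z k : R.

Lemma adjacent_slopes x y z : 0 <= x -> x <= y -> y <= z ->
  (phi z - phi y) * (y - x) <= (phi y - phi x) * (z - y).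
Proof.
move=> x0; rewrite le_eqVlt => /predU1P[->|xy].
  by move=> _; rewrite !subrr mulr0 mul0r.
rewrite le_eqVlt => /predU1P[->|yz]; first by rewrite !subrr mulr0 mul0r.
exact: concave_phi.
Qed.

(** The slope phi(x) / x of the chord from the origin decreases, since phi 0 = 0. *)
Lemma origin_slope x y : 0 <= x -> x <= y -> x * phi y <= y * phi x.
Proof. by move=> x0 xy; have := adjacent_slopes (lexx 0) x0 xy; rewrite phi0; nra. Qed.

(** For points with the same sum, concavity favours the inner pair: the chord
    slope over [x, y] is at least the one over [z, w], and these two intervals
    have the same length. *)
Lemma concave_nested_sum x y z w : 0 <= x -> x <= y -> y <= z -> x + w = y + z ->
  phi x + phi w <= phi y + phi z.
Proof.
move=> x0 xy yz xw.
have yw : y <= w by lra.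
have zw : z <= w by lra.
move: xy; rewrite le_eqVlt => /predU1P[xy|xy].
  have -> : w = z by lra.
  by rewrite xy.
have := adjacent_slopes x0 (ltW xy) yz; have := adjacent_slopes (le_trans x0 (ltW xy)) yz zw.
have -> : w - z = y - x by lra.
move: yz; rewrite le_eqVlt => /predU1P[yz|yz].
  rewrite -yz in xw zw *; move=> _ _.
  have := adjacent_slopes x0 (ltW xy) yw; have -> : w - y = y - x by lra.
  by rewrite ler_pM2r ?subr_gt0//; lra.
move=> h1 h2; have : (phi w - phi z) * (z - y) * (y - x) <= (phi y - phi x) * (z - y) * (y - x).
  apply: (@le_trans _ _ ((phi z - phi y) * (y - x) * (y - x))).
    by rewrite ler_pM2r ?subr_gt0.
  by rewrite ler_pM2r ?subr_gt0.
by rewrite !ler_pM2r ?subr_gt0//; lra.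
Qed.

Definition linear_upto s := forall x, 0 <= x <= s -> s * phi x = x * phi s.

(** As phi lies above its chord on [0, s] anyway, failing to be linear means to be
    strictly above it somewhere. *)
Lemma exists_above_chord s : 0 < s -> ~ linear_upto s ->
  exists2 x, 0 < x < s & x * phi s < s * phi x.
Proof.
move=> s0 /existsNP[x] /not_implyP[/andP[x0 xs]] /eqP ne; exists x.
  rewrite !lt_neqAle x0 xs !andbT; apply/andP; split.
    by apply: contra_not_neq (elimN eqP ne) => <-; rewrite phi0; lra.
  by apply: contra_not_neq (elimN eqP ne) => ->.
by rewrite lt_neqAle eq_sym ne origin_slope.
Qed.

(** If z is strictly above the chord on [0, s], then, for small x, the slope
    phi(x) / x is at least phi(z) / z > phi(s) / s, while phi(s - x) / (s - x) is
    at most phi(s) / (s - x), which tends to phi(s) / s as x does to 0. *)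
Lemma origin_slope_reflection_lt s :
    {in `[0, +oo[ &, {homo phi : x y / x <= y}} -> 0 < s -> ~ linear_upto s ->
  exists2 x, 0 < x < s / 2 & x * phi (s - x) < (s - x) * phi x.
Proof.
move=> mono s0 /(exists_above_chord s0)[z /andP[z0 zs] hz].
have phis0 : 0 <= phi s by rewrite -phi0 mono ?in_itv/= ?lexx ?(ltW s0).
have phiz0 : 0 < phi z.
  rewrite -(pmulr_rgt0 _ s0); apply: le_lt_trans hz.
  by rewrite mulr_ge0 ?(ltW z0).
(* d makes z * phi s < (s - x) * phi z for x <= d; the other two bounds give
   x <= z and x < s / 2 *)
pose d := (s * phi z - z * phi s) / (2 * phi z).
have d0 : 0 < d by rewrite divr_gt0 ?mulr_gt0// subr_gt0.
pose x := Num.min d (Num.min (z / 2) ((s - z) / 2)).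
have [xd xz xsz] : [/\ x <= d, x <= z / 2 & x <= (s - z) / 2].
  by rewrite /x !ge_min !lexx ?orbT.
have x0 : 0 < x.
  by rewrite !lt_min d0 /=; apply/andP; split; lra.
have sx0 : 0 < s - x by lra.
exists x; first by rewrite x0 /=; lra.
have h1 := @origin_slope x z (ltW x0) ltac:(lra).
have h2 : phi (s - x) <= phi s by rewrite mono ?in_itv/= ?(ltW sx0) ?(ltW s0)//; lra.
have h3 : z * phi s < (s - x) * phi z.
  have : x * (2 * phi z) <= s * phi z - z * phi s by rewrite -ler_pdivlMr// mulr_gt0.
  have : 0 < x * phi z by rewrite mulr_gt0.
  lra.
have h4 : x * (z * phi (s - x)) <= x * (z * phi s).
  by rewrite !ler_pM2l.
have h5 : x * (z * phi s) < x * ((s - x) * phi z) by rewrite ltr_pM2l.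
have h6 : (s - x) * (x * phi z) <= (s - x) * (z * phi x) by rewrite ler_pM2l.
by rewrite -(ltr_pM2l z0); lra.
Qed.

End concave.

(** * Basic facts on the class *)

Lemma convexN_concave_slopes (R : realType) (phi : R -> R) :
  convex_function (`[0, +oo[%classic : set R) (\- phi) -> concave_slopes phi.
Proof.
move=> cv x y z x0 xy yz.
have xz : 0 < z - x by rewrite subr_gt0 (lt_trans xy).
pose k := (z - y) / (z - x).
have k01 : 0 <= k <= 1.
  by apply/andP; split; [apply: divr_ge0; lra|rewrite ler_pdivrMr// mul1r; lra].
pose t := Itv01 (andP k01).1 (andP k01).2.
have tE : conv t (x : convex_lmodType R^o) z = y.
  suff : k * x + (1 - k) * z = y by [].
  by rewrite /k; field; lra.
have := cv t x z; rewrite tE !inE /= !in_itv/= !andbT x0.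
rewrite (le_trans x0 (ltW (lt_trans xy yz))) => /(_ isT isT).
have -> : conv t (- phi x : R^o) (- phi z) = k * - phi x + (1 - k) * - phi z by [].
rewrite -(ler_pM2l xz).
have kE : (z - x) * k = z - y by rewrite /k mulrC divfK//; lra.
have -> : (z - x) * (k * - phi x + (1 - k) * - phi z) =
   - ((z - x) * k) * phi x - ((z - x) - (z - x) * k) * phi z by ring.
by rewrite kE; lra.
Qed.

Section F12_facts.
Variables (R : realType) (f : R -> R).
Hypothesis hf : F12 f.
Local Notation phi := (derive1 f).
Implicit Types a b s x y : R.

Lemma F12_0 : f 0 = 0. Proof. by case: hf. Qed.

Lemma F12_even x : f (- x) = f x. Proof. by case: hf. Qed.

Lemma F12_is_derive x : is_derive x 1 f (phi x).
Proof.
by case: hf => -[df _] _ _ _ _; rewrite derive1E; apply: DeriveDef => //.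
Qed.

Lemma F12_is_derive_reflect s x : is_derive x 1 (fun y => f (s - y)) (- phi (s - x)).
Proof.
have := F12_is_derive (s - x) => h.
have g : is_derive x 1 (fun y : R => s - y) (-1).
  by rewrite -[-1]add0r; apply: is_deriveB.
have := @is_derive1_comp _ f (fun y : R => s - y) x _ _ h g; rewrite mulrN1; exact.
Qed.

Lemma F12_derive_odd x : phi (- x) = - phi x.
Proof.
have := F12_is_derive_reflect 0 x; rewrite sub0r.
have -> : (fun y => f (0 - y)) = f by apply/funext => y; rewrite sub0r F12_even.
by move=> h; rewrite [phi x]derive1E (@derive_val _ _ _ _ _ _ _ h) opprK.
Qed.

Lemma F12_derive_0 : phi 0 = 0.
Proof. by have := F12_derive_odd 0; rewrite oppr0; lra. Qed.

Lemma F12_derive_continuous : continuous phi.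
Proof. by case: hf => -[]. Qed.

Lemma F12_continuous : continuous f.
Proof.
by case: hf => -[df _] _ _ _ _ x; apply: differentiable_continuous; apply/derivable1_diffP.
Qed.

Lemma F12_derive_mono : {in `[0, +oo[ &, {homo phi : x y / x <= y}}.
Proof. by case: hf. Qed.

Lemma F12_derive_le x y : 0 <= x -> x <= y -> phi x <= phi y.
Proof.
move=> x0 xy; apply: F12_derive_mono => //; rewrite in_itv/= andbT//.
exact: le_trans xy.
Qed.

Lemma F12_derive_ge0 x : 0 <= x -> 0 <= phi x.
Proof. by move=> x0; rewrite -F12_derive_0 F12_derive_le. Qed.

Lemma F12_derive_concave : concave_slopes phi.
Proof. by apply: convexN_concave_slopes; case: hf. Qed.

Lemma F12_MVT a b : a < b -> exists2 c, a < c < b & f b - f a = phi c * (b - a).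
Proof.
move=> ab; have [||c cab e] := @MVT R f phi a b ab.
- by move=> x _; exact: F12_is_derive.
- by apply: continuous_subspaceT; exact: F12_continuous.
by exists c.
Qed.

Lemma F12_increment x y : 0 <= x -> x <= y ->
  (y - x) * phi x <= f y - f x /\ f y - f x <= (y - x) * phi y.
Proof.
move=> x0; rewrite le_eqVlt => /predU1P[->|xy]; first by rewrite !subrr !mul0r.
have [c /andP[xc cy] ->] := F12_MVT xy; rewrite ![(y - x) * _]mulrC.
have xy0 : 0 <= y - x by rewrite subr_ge0 ltW.
have c0 : 0 <= c by rewrite (le_trans x0)// ltW.
by split; apply: ler_wpM2r => //; apply: F12_derive_le => //; exact: ltW.
Qed.

Lemma F12_ge0 x : 0 <= x -> 0 <= f x.
Proof.
move=> x0; have [+ _] := F12_increment (lexx 0) x0.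
by rewrite F12_derive_0 mulr0 F12_0 subr0.
Qed.

Lemma F12_gt0 : f <> (fun=> 0) -> forall s, 0 < s -> 0 < f s.
Proof.
move=> f0 s s0; rewrite lt_neqAle F12_ge0 ?ltW// andbT eq_sym.
apply/eqP => fs; apply: f0.
have s20 : 0 < s / 2 by lra.
have phi2 : phi (s / 2) = 0.
  apply: le_anti; rewrite (F12_derive_ge0 (ltW s20)) andbT.
  have s2s : s / 2 <= s by lra.
  have [h _] := F12_increment (ltW s20) s2s.
  have h2 := F12_ge0 (ltW s20).
  have : (s - s / 2) * phi (s / 2) <= 0 by lra.
  by rewrite pmulr_rle0//; lra.
have phi_le0 x : 0 <= x -> phi x <= 0.
  move=> x0; have [xs|xs] := leP x (s / 2).
    by rewrite -phi2 F12_derive_le.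
  have := origin_slope F12_derive_concave F12_derive_0 (ltW s20) (ltW xs).
  by rewrite phi2 mulr0 pmulr_rle0.
have f_eq0 x : 0 <= x -> f x = 0.
  move=> x0; apply: le_anti; rewrite (F12_ge0 x0) andbT.
  have [_] := F12_increment (lexx 0) x0; rewrite F12_0 !subr0 => /le_trans; apply.
  by rewrite mulr_ge0_le0// phi_le0.
apply/funext => x; have [x0|x0] := leP 0 x; first exact: f_eq0.
by rewrite -F12_even f_eq0// oppr_ge0 ltW.
Qed.

(** The function f(y) - f(s - y) has derivative phi(y) + phi(s - y): this symmetric
    sum governs the part of L that does not involve s * phi. *)
Lemma F12_MVT_sum s a b : a < b -> exists2 c, a < c < b &
  (f b - f (s - b)) - (f a - f (s - a)) = (phi c + phi (s - c)) * (b - a).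
Proof.
move=> ab; pose F := fun y => f y - f (s - y).
have dF x : is_derive x 1 F (phi x + phi (s - x)).
  have h1 := F12_is_derive x; have h2 := F12_is_derive_reflect s x.
  by rewrite -[phi (s - x)]opprK; exact: is_deriveB.
have [|c cab e] := @MVT R F (fun x => phi x + phi (s - x)) a b ab (fun x _ => dF x).
  apply: continuous_subspaceT => x; apply: differentiable_continuous.
  by apply/derivable1_diffP; apply: (@ex_derive _ _ _ _ _ _ _ (dF x)).
by exists c.
Qed.

Lemma LE s x : L f s x = f (s - x) - f x + s * phi x.
Proof. by rewrite /L -F12_even opprB. Qed.

Lemma L_0 s : L f s 0 = f s.
Proof. by rewrite LE F12_derive_0 F12_0 !subr0 mulr0 addr0. Qed.

(** With k the slope of phi over [a, b], the increment of s * phi is s k (b - a).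
    Concavity and phi 0 = 0 give phi(z) >= k z on [0, b], and s - c <= a <= c, so
    phi(c) + phi(s - c) >= k s: the other part of L decreases at least as much. *)
Lemma L_nonincreasing_right s a b : s / 2 <= a -> a <= b -> b <= s ->
  L f s b <= L f s a.
Proof.
move=> sa; rewrite le_eqVlt => /predU1P[->//|ab] bs.
have a0 : 0 < a by lra.
have [c /andP[ac cb] e] := F12_MVT_sum s ab.
have cc := F12_derive_concave; have c0 := F12_derive_0.
rewrite !LE; suff : s * (phi b - phi a) <= (phi c + phi (s - c)) * (b - a) by lra.
pose k := (phi b - phi a) / (b - a).
have kE : k * (b - a) = phi b - phi a by rewrite /k divfK//; lra.
have h1 : a * k <= phi a.
  have := @adjacent_slopes _ _ cc 0 a b (lexx 0) (ltW a0) (ltW ab).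
  by rewrite c0 -kE => h; rewrite -(@ler_pM2r _ (b - a)) ?subr_gt0//; lra.
have h2 : (s - c) * k <= phi (s - c).
  have := @origin_slope _ _ cc c0 (s - c) a ltac:(lra) ltac:(lra) => h.
  rewrite -(ler_pM2l a0); apply: le_trans h.
  have -> : a * ((s - c) * k) = (s - c) * (a * k) by ring.
  by rewrite ler_wpM2l//; lra.
have h3 : c * k <= phi c.
  have := @adjacent_slopes _ _ cc a c b (ltW a0) (ltW ac) (ltW cb).
  have -> : phi b = phi a + k * (b - a) by lra.
  have h : 0 <= (b - a) by lra.
  move=> h'; have : (b - a) * (phi a + k * (c - a)) <= (b - a) * phi c by lra.
  by rewrite ler_pM2l ?subr_gt0//; lra.
rewrite -kE mulrA ler_wpM2r//; lra.
Qed.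

(** Here s * phi is concave, and f(s - y) - f(y) has derivative
    - (phi(y) + phi(s - y)), nonincreasing on [0, s / 2] by concave_nested_sum. *)
Lemma L_concave_left s x y z : 0 <= x -> x < y -> y < z -> z <= s / 2 ->
  (L f s z - L f s y) * (y - x) <= (L f s y - L f s x) * (z - y).
Proof.
move=> x0 xy yz zs; rewrite !LE.
have cc := F12_derive_concave.
have [a /andP[xa ay] ea] := F12_MVT_sum s xy.
have [b /andP[yb bz] eb] := F12_MVT_sum s yz.
have h := @concave_nested_sum _ _ cc a b (s - b) (s - a) ltac:(lra) ltac:(lra) ltac:(lra) ltac:(lra).
have h1 : (phi a + phi (s - a)) * ((z - y) * (y - x)) <= (phi b + phi (s - b)) * ((z - y) * (y - x)).
  by rewrite ler_wpM2r// ?mulr_ge0; lra.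
have h2 : s * ((phi z - phi y) * (y - x)) <= s * ((phi y - phi x) * (z - y)).
  by rewrite ler_wpM2l//; [lra|exact: cc].
have e1 : f (s - z) - f z = f (s - y) - f y - (phi b + phi (s - b)) * (z - y) by lra.
have e2 : f (s - x) - f x = f (s - y) - f y + (phi a + phi (s - a)) * (y - x) by lra.
rewrite e1 e2; lra.
Qed.

(** By concave_nested_sum the derivative phi(c) + phi(s - c) is largest at the
    right end of [0, x]. *)
Lemma L_ge_left s x : 0 <= x -> x <= s / 2 ->
  (s - x) * phi x - x * phi (s - x) <= L f s x - f s.
Proof.
rewrite le_eqVlt => /predU1P[<-|x0] xs.
  by rewrite L_0 F12_derive_0; lra.
have [c /andP[c0 cx]] := F12_MVT_sum s x0.
rewrite F12_0 !subr0 LE => e.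
have cc := F12_derive_concave.
have h := @concave_nested_sum _ _ cc c x (s - x) (s - c) ltac:(lra) ltac:(lra) ltac:(lra) ltac:(lra).
have : (phi c + phi (s - c)) * x <= (phi x + phi (s - x)) * x by rewrite ler_wpM2r//; lra.
lra.
Qed.

End F12_facts.

(** * Unimodality *)

Section peak.
Variables (R : realType) (f : R -> R).
Hypothesis hf : F12 f.
Local Notation phi := (derive1 f).
Implicit Types s x y p : R.

(** A maximiser of the continuous function L on [0, s / 2] is a peak: concavity
    makes L increase before it and decrease after it up to s / 2, and beyond
    s / 2 the function is nonincreasing anyway. *)
Lemma exists_peak s : 0 < s -> exists x, is_peak f s x.
Proof.
move=> s0.
have [||q + maxq] := @EVT_max R (L f s) 0 (s / 2); first lra.
  apply: continuous_subspaceT => x.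
  apply: (@cvgD _ _ _ _ _ (fun y => f (y - s) - f y) (fun y => s * phi y)).
    apply: (@cvgB _ _ _ _ _ (fun y => f (y - s)) f); last exact: (F12_continuous hf).
    apply: (@continuous_comp _ _ _ (fun y => y - s) f); last exact: (F12_continuous hf).
    by apply: cvgB; [exact: cvg_id|exact: cvg_cst].
  by apply: cvgMr; exact: (F12_derive_continuous hf).
rewrite in_itv/= => /andP[q0 qs].
(* a peak must be positive; since L (s / 2) >= L 0, a maximum reached at 0 is
   also reached at s / 2 *)
have [p /andP[p0 ps] maxp] : exists2 p, 0 < p <= s / 2 &
    forall x, 0 <= x <= s / 2 -> L f s x <= L f s p.
  move: q0; rewrite le_eqVlt => /predU1P[q0|q0]; last first.
    by exists q; [rewrite q0|exact: maxq].
  exists (s / 2); first by rewrite lexx andbT; lra.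
  move=> x xs; apply: (le_trans (maxq x xs)); rewrite -q0 (L_0 hf) -subr_ge0.
  have := @L_ge_left _ _ hf s (s / 2) ltac:(lra) (lexx _).
  have -> : s - s / 2 = s / 2 by lra.
  by rewrite subrr.
exists p; split.
- by rewrite p0 /=; lra.
- move=> x y; rewrite !in_itv/= => /andP[x0 xp] /andP[y0 yp].
  rewrite le_eqVlt => /predU1P[->//|xy].
  move: yp; rewrite le_eqVlt => /predU1P[->|yp]; first by rewrite maxp; lra.
  have h := L_concave_left hf (ltW x0) xy yp ps.
  have h1 := maxp y ltac:(lra).
  have : 0 <= (L f s p - L f s y) * (y - x) by rewrite mulr_ge0 ?subr_ge0// ltW.
  move=> /le_trans/(_ h); rewrite pmulr_lge0 ?subr_gt0//; lra.
- have left_ x y : p <= x -> x <= y -> y <= s / 2 -> L f s y <= L f s x.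
    move=> px; rewrite le_eqVlt => /predU1P[->//|xy] ys.
move: px; rewrite le_eqVlt => /predU1P[px|px]; first by rewrite -px maxp; lra.
    have h := L_concave_left hf (ltW p0) px xy ys.
    have h1 := maxp x ltac:(lra).
    have : (L f s x - L f s p) * (y - x) <= 0 by rewrite mulr_le0_ge0 ?subr_le0 ?subr_ge0// ltW.
    move=> /(le_trans h); rewrite pmulr_lle0 ?subr_gt0//; lra.
  move=> y x; rewrite !in_itv/= => /andP[py ys] /andP[px xs] xy.
  have [y2|y2] := leP y (s / 2); first exact: left_.
  have [x2|x2] := leP x (s / 2); last by apply: (L_nonincreasing_right hf); lra.
  apply: (@le_trans _ _ (L f s (s / 2))); last exact: left_.
  by apply: (L_nonincreasing_right hf); lra.
Qed.

Lemma peak_max s x : is_peak f s x -> is_max (L f s @` `]0, s[) (L f s x).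
Proof.
move=> [xs ml mr]; split; first by exists x => //=; rewrite in_itv.
move=> _ [y /= + <-]; rewrite in_itv/= => /andP[y0 ys]; case/andP: xs => x0 xs.
have [yx|/ltW xy] := leP y x; first by apply: ml; rewrite ?in_itv/= ?y0 ?x0 ?lexx.
by apply: mr => //; rewrite in_itv/= ?lexx ?xy.
Qed.

End peak.

(** * The second derivative and the limits of L' *)

Section second_derivative.
Variables (R : realType) (f : R -> R).
Hypothesis hf : F12 f.
Local Notation phi := (derive1 f).
Local Notation g := (second_deriv f).
Implicit Types x y z s : R.

Let quotient x (h : R) := h^-1 * (phi (x + h) - phi x).

(** The difference quotients of a concave function increase as the step shrinks,
    and on the right of x > 0 they are bounded by phi(x) / x: their limit is their
    supremum. *)
Lemma second_derivE x : 0 < x -> g x = sup (quotient x @` `]0, +oo[).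
Proof.
move=> x0; rewrite /second_deriv x0; apply/cvg_lim => //.
have cc := F12_derive_concave hf.
apply: (@nonincreasing_at_right_cvgr _ (quotient x) 0 +oo%O) => //.
- move=> h k; rewrite !in_itv/= !andbT => h0 k0.
  rewrite le_eqVlt => /predU1P[->//|hk]; rewrite /quotient.
  have := @adjacent_slopes _ _ cc x (x + h) (x + k) ltac:(lra) ltac:(lra) ltac:(lra).
  move=> e; rewrite [leLHS]mulrC [leRHS]mulrC ler_pdivrMr// mulrAC ler_pdivlMr//; lra.
- exists (phi x / x) => _ [h /= + <-]; rewrite in_itv/= andbT => h0.
  have := @adjacent_slopes _ _ cc 0 x (x + h) (lexx _) ltac:(lra) ltac:(lra).
  rewrite (F12_derive_0 hf) !subr0 => e.
  by rewrite /quotient mulrC ler_pdivrMr// mulrAC ler_pdivlMr//; lra.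
Qed.

Lemma second_deriv_le x z : 0 <= z -> z < x -> g x * (x - z) <= phi x - phi z.
Proof.
move=> z0 zx; have cc := F12_derive_concave hf.
rewrite second_derivE ?(le_lt_trans z0)// -ler_pdivlMr ?subr_gt0//.
apply: ge_sup; first by exists (quotient x 1), 1 => //=; rewrite in_itv/= ltr01.
move=> _ [h /= + <-]; rewrite in_itv/= andbT => h0.
have := @adjacent_slopes _ _ cc z x (x + h) z0 (ltW zx) ltac:(lra).
move=> e.
by rewrite /quotient mulrC ler_pdivrMr// mulrAC ler_pdivlMr ?subr_gt0//; lra.
Qed.

Lemma second_deriv_ge x y : 0 < x -> x < y -> phi y - phi x <= g x * (y - x).
Proof.
move=> x0 xy; have cc := F12_derive_concave hf.
rewrite second_derivE// -ler_pdivrMr ?subr_gt0//.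
apply: ub_le_sup; last first.
  exists (y - x); first by rewrite /= in_itv/= subr_gt0 xy.
  by rewrite /quotient mulrC subrKC.
exists (phi x / x) => _ [h /= + <-]; rewrite in_itv/= andbT => h0.
have := @adjacent_slopes _ _ cc 0 x (x + h) (lexx _) ltac:(lra) ltac:(lra).
rewrite (F12_derive_0 hf) !subr0 => e.
by rewrite /quotient mulrC ler_pdivrMr// mulrAC ler_pdivlMr//; lra.
Qed.

(** Both values are separated by the slope of phi over [x, y]. *)
Lemma second_deriv_anti x y : 0 < x -> x <= y -> g y <= g x.
Proof.
move=> x0; rewrite le_eqVlt => /predU1P[->//|xy].
have := le_trans (second_deriv_le (ltW x0) xy) (second_deriv_ge x0 xy).
by rewrite ler_pM2r ?subr_gt0.
Qed.

Lemma second_deriv_ge0 x : 0 < x -> 0 <= g x.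
Proof.
move=> x0; have h : phi x <= phi (x + 1) by rewrite (F12_derive_le hf) ?(ltW x0)//; lra.
have := @second_deriv_ge x (x + 1) x0 ltac:(lra).
by rewrite [x + 1 - x]addrAC subrr add0r mulr1; apply: le_trans; rewrite subr_ge0.
Qed.

(** Otherwise every slope of phi on ]0, s[ would be at most phi(s) / s, and going
    down from a point strictly above the chord would give phi(0) > 0. *)
Lemma exists_large_second_deriv s : 0 < s -> ~ linear_upto phi s ->
  exists2 x, 0 < x < s & phi s < s * g x.
Proof.
move=> s0 nl; apply: contrapT => none.
have gs x : 0 < x < s -> s * g x <= phi s.
  by move=> xs; rewrite leNgt; apply/negP => h; apply: none; exists x.
have [z /andP[z0 zs] hz] :=
  exists_above_chord (F12_derive_concave hf) (F12_derive_0 hf) s0 nl.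
(* below z the slopes do not exceed phi s / s, so phi stays above the positive
   constant phi z - z * phi s / s near 0 *)
have lb : 0 < phi z - z * phi s / s by rewrite subr_gt0 ltr_pdivrMr// [ltRHS]mulrC.
suff : phi z - z * phi s / s <= phi 0 by rewrite (F12_derive_0 hf) leNgt lb.
apply: (@cvgr_to_ge _ (0^'+) _ _ phi).
  by apply: cvg_at_right_filter; exact: F12_derive_continuous.
near=> x.
have x0 : 0 < x by near: x; exact: nbhs_right_gt.
have xz : x < z by near: x; exact: nbhs_right_lt.
have h1 := second_deriv_ge x0 xz.
have h2 : g x <= phi s / s by rewrite ler_pdivlMr// mulrC gs// x0 (lt_trans xz).
have h3 : g x * (z - x) <= phi s / s * (z - x) by rewrite ler_wpM2r ?subr_ge0 ?(ltW xz).
have h4 : 0 <= x * (phi s / s).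
  by rewrite !mulr_ge0 ?invr_ge0 ?(ltW x0) ?(ltW s0) ?(F12_derive_ge0 hf) ?(ltW s0).
lra.
Unshelve. all: by end_near. Qed.

(** The limit is s f''(0+) - phi(s), where f''(0+) is the supremum of the second
    derivative, possibly +oo; hence the limit in the extended reals. *)
Lemma L'_right_limit_pos s : 0 < s -> ~ linear_upto phi s ->
  exists l : \bar R, (L' f s x)%:E @[x --> (0:R)^'+] --> l /\ (0 < l)%E.
Proof.
move=> s0 nl; have [x /andP[x0 xs] hx] := exists_large_second_deriv s0 nl.
pose G (x : R) : \bar R := (s * g x)%:E.
exists ((- phi s)%:E + ereal_sup (G @` `]0%R, s[))%E; split.
  apply: (@cvgeD _ _ _ _ (fun x => (phi (x - s) - phi x)%:E) G).
  - by rewrite fin_num_adde_defr.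
  - apply: cvg_EFin; first by near=> y.
    have -> : - phi s = phi (0 - s) - phi 0.
      by rewrite sub0r (F12_derive_odd hf) (F12_derive_0 hf) subr0.
    apply: cvg_at_right_filter.
    apply: (@cvgB _ _ _ _ _ (fun y => phi (y - s)) phi); last first.
      exact: (F12_derive_continuous hf).
    apply: (@continuous_comp _ _ _ (fun y => y - s) phi); last first.
      exact: (F12_derive_continuous hf).
    by apply: cvgB; [exact: cvg_id|exact: cvg_cst].
  - apply: (@nonincreasing_at_right_cvge _ _ _ (BLeft s)); first by rewrite bnd_simp.
    move=> y z; rewrite !in_itv/= => /andP[y0 _] _ yz.
    by rewrite lee_fin; apply: ler_wpM2l; [exact: ltW|exact: second_deriv_anti].
apply: (@lt_le_trans _ _ ((- phi s)%:E + G x)%E).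
  by rewrite -EFinD lte_fin; lra.
by rewrite leeD2l//; apply: ereal_sup_ubound; exists x => //=; rewrite in_itv/= x0.
Unshelve. all: by end_near. Qed.

(** The limit is s f''(s-) - phi(s), where f''(s-) is at most the slope of phi over
    [z, s] for a point z strictly above the chord on [0, s], a slope smaller than
    phi(s) / s. *)
Lemma L'_left_limit_neg s : 0 < s -> ~ linear_upto phi s ->
  exists l : R, L' f s x @[x --> s^'-] --> l /\ l < 0.
Proof.
move=> s0 nl.
have [z /andP[z0 zs] hz] :=
  exists_above_chord (F12_derive_concave hf) (F12_derive_0 hf) s0 nl.
have [l hl] : exists l : R, g x @[x --> s^'-] --> l.
  suff : cvg (- g x @[x --> s^'-]).
    move=> /cvg_ex[l hl]; exists (- l).
    have -> : g = fun x => - (- g x) by apply/funext => x; rewrite opprK.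
    exact: (cvgN hl).
  apply: nondecreasing_at_left_is_cvgr; near=> x => /=.
  - have x0 : 0 < x by near: x; exact: nbhs_left_gt.
    move=> y w; rewrite !in_itv/= => /andP[y0 _] _ yw.
    by rewrite lerN2 second_deriv_anti// (lt_trans x0).
  - have x0 : 0 < x by near: x; exact: nbhs_left_gt.
    exists 0 => _ [y /= + <-]; rewrite in_itv/= => /andP[y0 _].
    by rewrite oppr_le0 second_deriv_ge0// (lt_trans x0).
exists (phi (s - s) - phi s + s * l); split.
  apply: (@cvgD _ _ _ _ _ (fun x => phi (x - s) - phi x) (fun x => s * g x)); last exact: cvgMr.
  apply: cvg_at_left_filter.
  apply: (@cvgB _ _ _ _ _ (fun y => phi (y - s)) phi); last first.
    exact: (F12_derive_continuous hf).
  apply: (@continuous_comp _ _ _ (fun y => y - s) phi); last first.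
    exact: (F12_derive_continuous hf).
  by apply: cvgB; [exact: cvg_id|exact: cvg_cst].
have : l * (s - z) <= phi s - phi z.
  apply: (@ler_cvg_to _ (s^'-) _ _ (fun x => g x * (x - z)) (fun x => phi x - phi z)).
  - apply: cvgM => //; apply: cvg_at_left_filter.
    by apply: cvgB; [exact: cvg_id|exact: cvg_cst].
  - apply: cvg_at_left_filter; apply: cvgB; last exact: cvg_cst.
    exact: F12_derive_continuous.
  near=> x; apply: second_deriv_le; first exact: ltW.
  by near: x; exact: nbhs_left_gt.
rewrite subrr (F12_derive_0 hf) sub0r => h.
have h1 : s * (l * (s - z)) <= s * (phi s - phi z) by rewrite ler_pM2l.
have h2 : s * (phi s - phi z) < phi s * (s - z) by lra.
have : s * l * (s - z) < phi s * (s - z) by lra.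
by rewrite ltr_pM2r ?subr_gt0//; lra.
Unshelve. all: by end_near. Qed.

End second_derivative.

(** * A criterion of constancy *)

Section squeeze.
Variable R : realType.
Implicit Types (D w : R -> R) (a b x y : R).

(** On a subdivision in n pieces of equal length h the increments of w telescope,
    so that the increment of D is at most h (w a - w b), which tends to 0. *)
Lemma constant_of_increment_le D w a b : a <= b ->
  (forall x y, a <= x -> x <= y -> y <= b ->
    `|D y - D x| <= (y - x) * (w x - w y)) -> D b = D a.
Proof.
move=> ab incr; apply/eqP; rewrite -subr_eq0 -normr_le0.
have bound n : `|D b - D a| * n.+1%:R <= (b - a) * (w a - w b).
  pose h := (b - a) / n.+1%:R; pose p i := a + i%:R * h.
  have h0 : 0 <= h by rewrite divr_ge0 ?subr_ge0.
  have hn : n.+1%:R * h = b - a by rewrite /h mulrC divfK.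
  have pn : p n.+1 = b by rewrite /p hn subrKC.
  have p0 : p 0%N = a by rewrite /p mul0r addr0.
  have pS i : p i.+1 - p i = h by rewrite /p -[i.+1]addn1 natrD; ring.
  have step i : (i <= n.+1)%N -> `|D (p i) - D a| <= h * (w a - w (p i)).
    elim: i => [_|i ih i_n]; first by rewrite p0 !subrr normr0 mulr0.
    apply: le_trans (ler_distD (D (p i)) _ _) _.
    have {}ih := ih (ltnW i_n).
    have := incr (p i) (p i.+1); rewrite pS => inc.
    have api : a <= p i by rewrite lerDl mulr_ge0.
    have pib : p i.+1 <= b by rewrite -pn lerD2l ler_wpM2r// ler_nat.
    have {}inc : `|D (p i.+1) - D (p i)| <= h * (w (p i) - w (p i.+1)).
      by apply: inc => //; rewrite -subr_ge0 pS.
    by apply: le_trans (lerD inc ih) _; rewrite -mulrDr ler_wpM2l//; lra.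
  have := step n.+1 (leqnn _); rewrite pn => le.
  have : `|D b - D a| * n.+1%:R <= h * (w a - w b) * n.+1%:R by rewrite ler_wpM2r.
  by move=> /le_trans; apply; rewrite -hn; lra.
rewrite leNgt; apply/negP => d0.
have C0 : 0 <= (b - a) * (w a - w b).
  by apply: le_trans (bound 0%N); rewrite mulr_ge0.
have := archi_boundP (divr_ge0 C0 (ltW d0)).
set B := Num.Def.archi_bound _.
rewrite ltr_pdivrMr// [ltRHS]mulrC => /(le_lt_trans (bound B)).
by rewrite ltr_pM2l// ltr_nat ltnNge leqnSn.
Qed.

End squeeze.

Section clip.
Variable R : realType.
Implicit Types (t : \bar R) (a b x y r : R).

(** The minimum of t and a, as a real number: half the derivative of psi_t at
    a >= 0. *)
Definition clip t a : R := fine (mine t a%:E).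

Lemma clip_fin r a : clip r%:E a = Num.min r a.
Proof. by rewrite /clip -EFin_min. Qed.

Lemma clip_pinfty a : clip +oo%E a = a.
Proof. by rewrite /clip minC /Order.min ltry. Qed.

Lemma EFin_clip t a : (0 < t)%E -> (clip t a)%:E = mine t a%:E.
Proof.
case: t => [r _|_|//]; first by rewrite clip_fin EFin_min.
by rewrite clip_pinfty minC /Order.min ltry.
Qed.

Lemma clip_ge0 t a : (0 < t)%E -> 0 <= a -> 0 <= clip t a.
Proof.
case: t => [r|_|//]; last by rewrite clip_pinfty.
by rewrite clip_fin lte_fin le_min => /ltW -> ->.
Qed.

Lemma clip_le t a : (0 < t)%E -> clip t a <= a.
Proof.
case: t => [r _|_|//]; last by rewrite clip_pinfty.
by rewrite clip_fin ge_min lexx orbT.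
Qed.

Lemma clip_id t a : (a%:E <= t)%E -> clip t a = a.
Proof.
case: t => [r|_|//]; last by rewrite clip_pinfty.
by rewrite clip_fin lee_fin => ?; rewrite min_r.
Qed.

Lemma clip_mono t a b : (0 < t)%E -> a <= b -> clip t a <= clip t b.
Proof.
case: t => [r _|_|//]; last by rewrite !clip_pinfty.
by rewrite !clip_fin => ab; case: (leP r a); case: (leP r b); lra.
Qed.

Lemma clip_lipschitz t a b : (0 < t)%E -> a <= b -> clip t b - clip t a <= b - a.
Proof.
case: t => [r _|_|//]; last by rewrite !clip_pinfty.
by rewrite !clip_fin => ab; case: (leP r a); case: (leP r b); lra.
Qed.

(** A strict increase of min(t, .) can only start before t. *)
Lemma clip_lt t a b : (0 < t)%E -> a <= b -> clip t a < clip t b -> (a%:E < t)%E.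
Proof.
case: t => [r _|_|//]; last by rewrite ltry.
by rewrite !clip_fin lte_fin => ab; case: (leP r a); case: (leP r b); lra.
Qed.

(** Since max(0, |x| - t) = |x| - min(t, |x|): a formula also valid for t = +oo,
    which makes psi a polynomial in the truncation. *)
Lemma psi_clip t x : (0 < t)%E ->
  psi t x = 2 * `|x| * clip t `|x| - clip t `|x| ^+ 2.
Proof.
case: t => [r|_|//]; last first.
  by rewrite clip_pinfty /= -[LHS]real_normK ?num_real//; ring.
rewrite lte_fin clip_fin /= => r0; rewrite -[x ^+ 2]real_normK ?num_real//.
have [h|h] := leP r `|x|; first by rewrite max_r ?subr_ge0//; ring.
by rewrite max_l ?subr_le0 ?ltW//; ring.
Qed.

Lemma psi_0 t : (0 < t)%E -> psi t 0 = 0.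
Proof.
move=> t0; rewrite psi_clip// normr0.
have -> : clip t 0 = 0 by apply: clip_id; exact: ltW.
by rewrite mulr0 expr2 mulr0 subrr.
Qed.

Lemma psi_norm t x : psi t `|x| = psi t x.
Proof.
by case: t => //= [r|]; rewrite ?normr_id real_normK// num_real.
Qed.

(** The next two bounds say that psi_t has derivative 2 min(t, x) in x, which is
    nondecreasing. *)
Lemma psi_increment_ge t x y : (0 < t)%E -> 0 <= x -> x <= y ->
  2 * clip t x * (y - x) <= psi t y - psi t x.
Proof.
move=> t0 x0 xy; rewrite !psi_clip// !ger0_norm ?(le_trans x0)//.
have := clip_le x t0; have := clip_le y t0; have := clip_mono t0 xy.
move: (clip t x) (clip t y) => c d cd dy cx.
have : 0 <= (d - c) * (2 * y - d - c) by rewrite mulr_ge0//; lra.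
lra.
Qed.

Lemma psi_increment_le t x y : (0 < t)%E -> 0 <= x -> x <= y ->
  psi t y - psi t x <= 2 * clip t y * (y - x).
Proof.
move=> t0 x0 xy; rewrite !psi_clip// !ger0_norm ?(le_trans x0)//.
have cd := clip_mono t0 xy.
have sat : clip t x = clip t y \/ clip t x = x.
  move: (cd); rewrite le_eqVlt => /predU1P[|]; first by left.
  by move=> /(clip_lt t0 xy)/ltW/clip_id; right.
move: (clip t x) (clip t y) cd sat => c d cd.
case=> [->|cx]; first lra.
have : 0 <= (d - c) * (d + c - 2 * x) by rewrite mulr_ge0//; lra.
lra.
Qed.

Lemma psi_le t x y : (0 < t)%E -> 0 <= x -> x <= y -> psi t x <= psi t y.
Proof.
move=> t0 x0 xy; rewrite -subr_ge0; apply: le_trans (psi_increment_ge t0 x0 xy).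
by rewrite !mulr_ge0 ?clip_ge0 ?subr_ge0.
Qed.

Lemma psi_ge0 t x : (0 < t)%E -> 0 <= psi t x.
Proof. by move=> t0; rewrite -psi_norm -(psi_0 t0) psi_le. Qed.

Lemma measurable_clip a : measurable_fun [set: \bar R] (clip ^~ a).
Proof.
apply: measurableT_comp; first exact: fine_measurable.
by apply: measurable_mine; [exact: measurable_id|exact: measurable_cst].
Qed.

Lemma measurable_psi x :
  measurable_fun `]0%E, +oo%E]%classic (fun t : \bar R => (psi t x)%:E).
Proof.
apply: (@eq_measurable_fun _ _ _ _ _
    (fun t => (2 * `|x| * clip t `|x| - clip t `|x| ^+ 2)%:E)).
  by move=> t; rewrite inE /= in_itv/= => /andP[t0 _]; rewrite psi_clip.
apply/measurable_EFinP; apply: measurable_funTS; apply: measurable_funB.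
  by apply: measurable_funM; [exact: measurable_cst|exact: measurable_clip].
by apply: measurable_funX; exact: measurable_clip.
Qed.

End clip.

(** * The support of a representing measure *)

Section support.
Variables (R : realType) (f : R -> R) (g : {measure set (\bar R) -> \bar R}).
Hypothesis fg : represents f g.
Implicit Types (s x : R) (t : \bar R).

(** An open set of extended reals is the image of an open set of reals, up to the
    two infinite points. *)
Lemma open_emeasurable (U : set (\bar R)) : open U -> measurable U.
Proof.
move=> oU.
have -> : U = EFin @` (EFin @^-1` U) `|` (U `&` [set -oo%E]) `|` (U `&` [set +oo%E]).
  apply/seteqP; split => [[r| |] Ut|t].
  - by left; left; exists r.
  - by right.
  - by left; right.
  - by move=> [[[r Ur <-]|[]]|[]].
have single (t : \bar R) : measurable (U `&` [set t]).
  have [Ut|Ut] := pselect (U t).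
    rewrite (_ : _ `&` _ = [set t])//; apply/seteqP; split => [x []//|x ->].
    by split.
  by rewrite (_ : _ `&` _ = set0)//; apply/seteqP; split => // x [] /[swap] ->.
apply: measurableU; last exact: single.
apply: measurableU; last exact: single.
apply: measurable_image_EFin; apply: open_measurable.
rewrite openE => r Ur; rewrite /interior.
by have := open_nbhs_nbhs (conj oU Ur).
Qed.

(** Every point of ]0, s[ lies outside the support, hence in an interval with
    rational end points that is a null set; there are countably many of those. *)
Lemma null_below_supp s : (s%:E <= ereal_inf (supp g))%E ->
  g `]0%E, s%:E[%classic = 0%E.
Proof.
move=> s_inf.
pose I (p : rat * rat) : set (\bar R) :=
  `](ratr p.1 : R)%:E, (ratr p.2 : R)%:E[%classic `&` `]0%E, +oo%E]%classic.
pose F n := if @unpickle (rat * rat)%type n is Some p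
            then if g (I p) == 0%E then I p else set0 else set0.
have mI p : measurable (I p) by apply: measurableI; exact: emeasurable_itv.
apply: measure_negligible; first exact: emeasurable_itv.
apply: (@negligibleS _ _ _ _ (\bigcup_n F n)); last first.
  apply: negligible_bigcup => n; rewrite /F; case: unpickle => [p|]; last first.
    exact: negligible_set0.
  by case: eqP => [p0|_]; [apply/negligibleP|exact: negligible_set0].
move=> [r| |]; rewrite /= in_itv//= => /andP[r0 rs].
have : ~ supp g r%:E.
  by move=> /ereal_inf_lbound/(le_trans s_inf); rewrite leNgt rs.
move=> /not_andP[/(_ r0)//|/existsNP[U /not_implyP[oU /not_implyP[Ur /negP gU]]]].
have /nbhs_ballP[e /= e0 eU] : nbhs r (EFin @^-1` U).
  by have := open_nbhs_nbhs (conj oU Ur).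
have [p] := @rat_in_itvoo R (r - e) r ltac:(lra).
rewrite in_itv/= => /andP[ep pr].
have [q] := @rat_in_itvoo R r (r + e) ltac:(lra).
rewrite in_itv/= => /andP[rq qe].
have [n nE] : exists n, @unpickle (rat * rat)%type n = Some (p, q).
  by exists (pickle (p, q)); exact: pickleK.
exists n; [exact: Logic.I|rewrite /F nE].
have gI : g (I (p, q)) = 0%E.
  have : g (U `&` `]0%E, +oo%E]%classic) = 0%E.
    by apply/eqP; move: gU; rewrite lt0e measure_ge0 andbT negbK.
  apply: subset_measure0 => //.
    by apply: measurableI; [exact: open_emeasurable|exact: emeasurable_itv].
  move=> t [/= tpq t0]; split => //; move: t tpq t0 => [y| |]; rewrite /= !in_itv//=.
  rewrite !lte_fin => /andP[py yq] _; apply: eU.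
  by rewrite /ball/= ltr_distlC (lt_trans ep py) (lt_trans yq qe).
  by rewrite [(+oo < _)%E]ltNge leey andbF.
rewrite gI eqxx; split; rewrite /= in_itv/= ?r0 ?leey//.
  by rewrite !lte_fin pr rq.
by move: rs; rewrite ltNge leey.
Qed.

Lemma ge_supp_of_null s : g `]0%E, s%:E[%classic = 0%E ->
  (s%:E <= ereal_inf (supp g))%E.
Proof.
move=> g0; apply: le_ereal_inf_tmp => t [t0 tsupp].
rewrite leNgt; apply/negP => ts.
have oU : open [set t | (t < s%:E)%E].
  by rewrite openE => x /= xs; exact: open_ereal_lt_ereal.
have := tsupp _ oU ts.
rewrite (_ : _ `&` _ = `]0%E, s%:E[%classic) ?g0 ?ltxx//.
apply/seteqP; split => x; rewrite /= !in_itv/=.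
  by move=> [xs /andP[->]].
by move=> /andP[-> ->]; rewrite leey.
Qed.

(** If almost every t is >= s, then psi_t(x) = x^2 for almost every t when
    |x| <= s. *)
Lemma quadratic_of_null s : 0 < s -> g `]0%E, s%:E[%classic = 0%E ->
  forall x, `|x| <= s -> s ^+ 2 * f x = x ^+ 2 * f s.
Proof.
case: fg => _ _ fE s0 g0 x xs.
apply: EFin_inj; rewrite (EFinM _ (f x)) (EFinM _ (f s)) !fE.
have psi0 y t : `]0%E, +oo%E]%classic t -> (0 <= (psi t y)%:E)%E.
  by rewrite /= in_itv/= lee_fin => /andP[t0 _]; exact: psi_ge0.
have Z (a y : R) : 
    ((a ^+ 2)%:E * (\int[g]_(t in `]0%E, +oo%E]) (psi t y)%:E))%E =
    (\int[g]_(t in `]0%E, +oo%E]) ((a ^+ 2)%:E * (psi t y)%:E))%E.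
  rewrite ge0_integralZl//; [exact: emeasurable_itv|exact: measurable_psi|exact: psi0|].
  by rewrite lee_fin sqr_ge0.
rewrite !Z.
apply: ge0_ae_eq_integral; first exact: emeasurable_itv.
- by apply: measurable_funeM; exact: measurable_psi.
- by apply: measurable_funeM; exact: measurable_psi.
- by move=> t tD; rewrite mule_ge0 ?psi0// lee_fin sqr_ge0.
- by move=> t tD; rewrite mule_ge0 ?psi0// lee_fin sqr_ge0.
exists `]0%E, s%:E[%classic; split; [exact: emeasurable_itv|exact: g0|].
move=> t /= /not_implyP[].
rewrite in_itv/= => /andP[t0 _] ne; rewrite in_itv/= t0 /= ltNge.
apply: contra_notN ne => st; rewrite -!EFinM !psi_clip// (ger0_norm (ltW s0)).
rewrite (clip_id st) clip_id; last by apply: le_trans st; rewrite lee_fin.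
rewrite -[x ^+ 2]real_normK ?num_real//; congr EFin; ring.
Qed.

(** The quotient psi_t(x) / x^2 does not increase from x = s / 2 to x = s, and it
    decreases strictly when t < s. *)
Lemma psi_half_le s t : 0 < s -> (0 < t)%E -> psi t s <= 4 * psi t (s / 2).
Proof.
move=> s0 t0; rewrite !psi_clip// !ger0_norm; try lra.
case: t t0 => [r| |//]; last by rewrite !clip_pinfty; nra.
rewrite lte_fin !clip_fin => r0; case: (leP r s); case: (leP r (s / 2)); nra.
Qed.

Lemma psi_half_lt s t : 0 < s -> (0 < t < s%:E)%E -> psi t s < 4 * psi t (s / 2).
Proof.
move=> s0 /andP[t0 ts]; rewrite !psi_clip// !ger0_norm; try lra.
case: t t0 ts => [r| |//]; last by move=> _; rewrite ltNge leey.
rewrite !lte_fin !clip_fin => r0 rs; case: (leP r s); case: (leP r (s / 2)); nra.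
Qed.

(** The integral of the nonnegative function 4 psi_t(s / 2) - psi_t(s) vanishes,
    and this function is positive on ]0, s[. *)
Lemma null_of_quadratic s : 0 < s -> 4 * f (s / 2) = f s ->
  g `]0%E, s%:E[%classic = 0%E.
Proof.
case: fg => _ _ fE s0 fs.
pose D : set (\bar R) := `]0%E, +oo%E]%classic.
have Dpos t : D t -> (0 < t)%E by rewrite /D /= in_itv/= => /andP[].
pose d t : \bar R := (4 * psi t (s / 2) - psi t s)%:E.
have d0 t : D t -> (0 <= d t)%E.
  by move=> /Dpos t0; rewrite lee_fin subr_ge0 psi_half_le.
have psi0 y t : D t -> (0 <= (psi t y)%:E)%E.
  by move=> /Dpos t0; rewrite lee_fin psi_ge0.
have md : measurable_fun D d.
  apply/measurable_EFinP; apply: measurable_funB.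
    by apply: measurable_funM => //; apply/measurable_EFinP; exact: measurable_psi.
  by apply/measurable_EFinP; exact: measurable_psi.
have int_d : (\int[g]_(t in D) d t = 0)%E.
  have : (\int[g]_(t in D) d t + (f s)%:E = (f s)%:E)%E.
    rewrite {1}fE -ge0_integralD//; try exact: emeasurable_itv; try exact: measurable_psi; try exact: psi0.
    rewrite -fs EFinM fE -ge0_integralZl//; try exact: emeasurable_itv; try exact: measurable_psi; try exact: psi0.
    by apply: eq_integral => t _; rewrite -EFinD subrK EFinM.
  by case: (\int[g]_(t in D) d t)%E => [a| |]//= [] ?; congr EFin; lra.
apply: measure_negligible; first exact: emeasurable_itv.
have : ae_eq g D d (cst 0%E).
  apply/(ae_eq_integral_abs g (emeasurable_itv _) md); rewrite -[RHS]int_d.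
  by apply: eq_integral => t /set_mem/d0/gee0_abs.
apply: negligibleS => t /=; rewrite in_itv/= => /andP[t0 ts] /= H.
have : D t by rewrite /D/= in_itv/= t0 leey.
move=> /H [] /eqP; rewrite subr_eq0 => /eqP e.
by have := @psi_half_lt s t s0; rewrite t0 ts => /(_ isT); rewrite e ltxx.
Qed.

End support.

(** * The measure carried by the second derivative *)

Section representing_measure.
Variables (R : realType) (f : R -> R).
Hypothesis hf : F12 f.
Local Notation phi := (derive1 f).
Local Notation g := (second_deriv f).
Implicit Types (u x y a b : R).

(** The generalised inverse of half the second derivative, with values in
    [0, +oo].  It is set to 0 for u <= 0, and also where the second derivative
    never exceeds 2u; the corresponding mass at 0 is discarded by restricting to
    ]0, +oo] below. *)
Definition level u : \bar R :=
  ereal_sup [set x%:E | x in [set x | x = 0 \/ [/\ 0 < u, 0 < x & 2 * u < g x]]].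

Lemma level_ge0 u : (0 <= level u)%E.
Proof. by apply: ereal_sup_ubound; exists 0 => //; left. Qed.

Lemma level_ge u x : 0 < u -> 0 < x -> 2 * u < g x -> (x%:E <= level u)%E.
Proof. by move=> u0 x0 ug; apply: ereal_sup_ubound; exists x => //; right. Qed.

Lemma level_gt u a : 0 <= a -> (a%:E < level u)%E ->
  exists x, [/\ 0 < u, a < x & 2 * u < g x].
Proof.
move=> a0 /ereal_sup_gt[_ [x /= xs <-]]; rewrite lte_fin => ax; exists x.
by case: xs => [x0|[? ? ?]]; [move: ax; rewrite x0 ltNge a0|].
Qed.

Lemma level_gt0 u : (0 < level u)%E -> 0 < u.
Proof. by move=> /(level_gt (lexx 0))[x []]. Qed.

Lemma level_gt_second_deriv u a : 0 < a -> (a%:E < level u)%E -> 2 * u < g a.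
Proof.
move=> a0 /(level_gt (ltW a0))[x [u0 ax ug]]; apply: lt_le_trans ug _.
by apply: second_deriv_anti => //; exact: ltW.
Qed.

(** The sets where the function exceeds r are intervals: for r >= 0 because it is
    nonincreasing on ]0, +oo[ and 0 elsewhere. *)
Lemma measurable_level : measurable_fun [set: R] level.
Proof.
apply: (measurability _ (ErealGenOInfty.measurableE R)) => // _ [_ [r ->] <-].
rewrite setTI; apply: is_interval_measurable => x y /=.
rewrite !in_itv/= !andbT => xr yr z /andP[xz zy].
rewrite in_itv/= andbT.
have [r0|r0] := ltP r 0; first by apply: lt_le_trans (level_ge0 z); rewrite lte_fin.
have [t [u0 rt yt]] := level_gt r0 yr; have [_ [x0 _ _]] := level_gt r0 xr.
apply: (@lt_le_trans _ _ t%:E); first by rewrite lte_fin.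
apply: level_ge; [exact: (lt_le_trans x0 xz)|exact: (le_lt_trans r0 rt)|].
by apply: le_lt_trans yt; rewrite ler_pM2l.
Qed.

Local Notation positive := (`]0%E, +oo%E]%classic : set (\bar R)).
Local Notation mu := (@lebesgue_measure R).
Local Notation D := (level @^-1` positive).

Lemma pre_positive u : D u -> (0 < level u)%E.
Proof. by rewrite /= in_itv/= => /andP[]. Qed.

Lemma measurable_pre_positive : measurable D.
Proof.
by rewrite -[X in measurable X]setTI; apply: measurable_level => //; exact: emeasurable_itv.
Qed.

(** The restriction to ]0, +oo] of the image of Lebesgue measure under level; the
    change of variables is what remains to be known about it. *)
Lemma level_measure : exists2 m : {measure set (\bar R) -> \bar R},
  m (~` positive) = 0%E &
  forall h : \bar R -> \bar R, measurable_fun positive h ->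
    (forall t, positive t -> (0 <= h t)%E) ->
    (\int[m]_(t in positive) h t = \int[mu]_(u in D) h (level u))%E.
Proof.
pose image := (pushforward mu level : {measure set (\bar R) -> \bar R}).
pose p := image measurable_level.
have mP : measurable positive by exact: emeasurable_itv.
pose m : {measure set (\bar R) -> \bar R} := mrestr p mP.
exists m.
  rewrite /m/= /mrestr setICl. exact: (measure0 p).
move=> h mh h0; rewrite (eq_measure_integral p).
  by rewrite ge0_integral_pushforward//; [exact: measurable_level|move=> t /set_mem; exact: h0].
by move=> A mA AP; rewrite /m /= /mrestr setIidl.
Qed.

End representing_measure.

Section representation.
Variables (R : realType) (f : R -> R).
Hypothesis hf : F12 f.
Local Notation phi := (derive1 f).
Local Notation g := (second_deriv f).
Local Notation positive := (`]0%E, +oo%E]%classic : set (\bar R)).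
Local Notation mu := (@lebesgue_measure R).
Local Notation D := (level f @^-1` positive).
Implicit Types (u x y z a b : R).

Let mD : measurable D. Proof. exact: measurable_pre_positive. Qed.
Let pos u : D u -> (0 < level f u)%E. Proof. exact: pre_positive. Qed.

Lemma measurable_clip_level a : measurable_fun D (fun u => clip (level f u) a).
Proof.
apply: measurable_funTS.
exact: (measurableT_comp (measurable_clip a) (measurable_level f)).
Qed.

Definition clip_integral x y : \bar R :=
  (\int[mu]_(u in D) (clip (level f u) y - clip (level f u) x)%:E)%E.

Let measurable_clipB x y :
  measurable_fun D (fun u => (clip (level f u) y - clip (level f u) x)%:E).
Proof. by apply/measurable_EFinP; apply: measurable_funB; exact: measurable_clip_level. Qed.

Let clipB_ge0 x y : x <= y -> forall u, D u ->
  (0 <= (clip (level f u) y - clip (level f u) x)%:E)%E.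
Proof. by move=> xy u /pos u0; rewrite lee_fin subr_ge0 clip_mono. Qed.

Lemma clip_integralD x y z : x <= y -> y <= z ->
  clip_integral x z = (clip_integral x y + clip_integral y z)%E.
Proof.
move=> xy yz; rewrite /clip_integral -ge0_integralD//; try exact: clipB_ge0; try exact: measurable_clipB.
by apply: eq_integral => u _; rewrite -EFinD; congr EFin; ring.
Qed.

Let indicator_integral (c d : R) : 0 <= c -> 0 <= d ->
  (\int[mu]_(u in D) (c%:E * (\1_(`]0%R, d[%classic : set R) u)%:E) =
   c%:E * mu (`]0%R, d[%classic `&` D))%E.
Proof.
move=> c0 d0; rewrite ge0_integralZl//.
- by rewrite integral_indic.
- exact/measurable_EFinP/measurable_indic.
Qed.

Let measure_oo (d : R) : 0 <= d -> mu `]0%R, d[%classic = d%:E.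
Proof.
rewrite le_eqVlt => /predU1P[<-|d0]; first by rewrite set_itvoo0 measure0.
by rewrite lebesgue_measure_itv/= lte_fin d0 oppr0 adde0.
Qed.

(** The integrand is at most y - x, and it vanishes unless level u > x, which
    forces 2u < f''(x). *)
Lemma clip_integral_le x y : 0 < x -> x <= y ->
  (clip_integral x y <= ((y - x) * (g x / 2))%:E)%E.
Proof.
move=> x0 xy; have xy0 : 0 <= y - x by rewrite subr_ge0.
have g0 : 0 <= g x / 2 by rewrite divr_ge0 ?second_deriv_ge0.
apply: (@le_trans _ _ (\int[mu]_(u in D)
    ((y - x)%:E * (\1_(`]0%R, (g x / 2)%R[%classic : set R) u)%:E))%E).
  apply: ge0_le_integral; [exact: mD|exact: clipB_ge0|exact: measurable_clipB| |].
    by apply: measurable_funeM; exact/measurable_EFinP/measurable_indic.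
  move=> u /pos u0; rewrite -EFinM lee_fin indicE.
  have [->|ne] := eqVneq (clip (level f u) x) (clip (level f u) y).
    by rewrite subrr mulr_ge0.
  have /(clip_lt u0 xy) xu : clip (level f u) x < clip (level f u) y.
    by rewrite lt_neqAle ne clip_mono.
  have -> : u \in `]0%R, (g x / 2)%R[%classic.
    rewrite inE/= in_itv/= (level_gt0 u0)/= ltr_pdivlMr// mulrC.
    exact: level_gt_second_deriv.
  by rewrite mulr1 clip_lipschitz.
rewrite indicator_integral// EFinM lee_wpmul2l ?lee_fin// -[leRHS]measure_oo//.
have mI : measurable (`]0%R, (g x / 2)%R[%classic : set R) by exact: measurable_itv.
apply: le_measure; rewrite ?inE//; exact: measurableI.
Qed.

(** The integrand equals y - x where level u >= y, which holds when
    0 < 2u < f''(y). *)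
Lemma clip_integral_ge x y : 0 < x -> x <= y ->
  (((y - x) * (g y / 2))%:E <= clip_integral x y)%E.
Proof.
move=> x0 xy; have xy0 : 0 <= y - x by rewrite subr_ge0.
have y0 : 0 < y by exact: lt_le_trans xy.
have g0 : 0 <= g y / 2 by rewrite divr_ge0 ?second_deriv_ge0.
have sat u : `]0%R, (g y / 2)%R[%classic u -> (y%:E <= level f u)%E.
  rewrite /= in_itv/= ltr_pdivlMr// mulrC => /andP[u0 uy].
  exact: level_ge.
apply: (@le_trans _ _ (\int[mu]_(u in D)
    ((y - x)%:E * (\1_(`]0%R, (g y / 2)%R[%classic : set R) u)%:E))%E).
  rewrite indicator_integral// EFinM lee_wpmul2l ?lee_fin//.
  rewrite (_ : _ `&` D = `]0%R, (g y / 2)%R[%classic) ?measure_oo//.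
  apply/seteqP; split => u; first by case.
  move=> ug; split => //; rewrite /= in_itv/= leey andbT.
  by apply: lt_le_trans (sat _ ug); rewrite lte_fin.
apply: ge0_le_integral; [exact: mD| | |exact: measurable_clipB|].
- by move=> u Du; rewrite mule_ge0// lee_fin.
- by apply: measurable_funeM; exact/measurable_EFinP/measurable_indic.
move=> u Du; have u0 := pos Du; rewrite -EFinM lee_fin indicE.
have [/set_mem/sat yu|_] := boolP (u \in _).
  by rewrite mulr1 (clip_id yu) clip_id//; apply: le_trans yu; rewrite lee_fin.
by rewrite mulr0 subr_ge0 clip_mono.
Qed.

(** The bounds of the two previous lemmas also hold for half the increment of phi,
    by concavity. *)
Lemma clip_integral_derive x y : 0 < x -> x <= y ->
  clip_integral x y = ((phi y - phi x) / 2)%:E.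
Proof.
move=> x0 xy.
have fin z : x <= z -> clip_integral x z \is a fin_num.
  move=> xz; rewrite ge0_fin_numE ?(le_lt_trans (clip_integral_le x0 xz)) ?ltry//.
  by apply: integral_ge0 => u; exact: clipB_ge0.
pose E z := fine (clip_integral x z) - phi z / 2.
suff : E y = E x.
  rewrite /E; have -> : clip_integral x x = 0%E.
    by rewrite /clip_integral integral0_eq// => u _; rewrite subrr.
  by move=> /= e; rewrite -[LHS]fineK ?fin//; congr EFin; lra.
apply: (@constant_of_increment_le _ E (fun z => g z / 2) x y xy) => a b xa ab yb.
have a0 : 0 < a by exact: lt_le_trans xa.
have := clip_integral_le a0 ab; have := clip_integral_ge a0 ab.
have e := clip_integralD xa ab.
have fa := fin _ xa; have fb := fin _ (le_trans xa ab).
have -> : clip_integral a b = (fine (clip_integral x b) - fine (clip_integral x a))%:E.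
  move: e fb; rewrite -(fineK fa); case: (clip_integral a b) => [r| |] -> //= _.
  by congr EFin; lra.
rewrite !lee_fin => h1 h2; rewrite /E.
have [h3 h4] : (b - a) * g b <= phi b - phi a /\ phi b - phi a <= (b - a) * g a.
  move: ab; rewrite le_eqVlt => /predU1P[->|ab]; first by rewrite !subrr !mul0r.
  split; rewrite [(b - a) * _]mulrC; last exact: second_deriv_ge.
  by apply: second_deriv_le => //; exact: ltW.
rewrite ler_norml; move: h1 h2 h3 h4; clear.
move: (fine _) (fine _) (phi a) (phi b) (g a) (g b) => *.
by apply/andP; split; lra.
Qed.

(** Monotone convergence from x = y / n, as phi is continuous at 0.  The starting
    point 0 is out of reach of the previous lemma, because the second derivative
    may be unbounded there. *)
Lemma clip_integral_0 y : 0 < y -> clip_integral 0 y = (phi y / 2)%:E.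
Proof.
move=> y0; pose a n : R := y / n.+1%:R.
have a0 n : 0 < a n by rewrite divr_gt0.
have ay n : a n <= y by rewrite ler_pdivrMr//; apply: ler_peMr; [exact: ltW|rewrite ler1n].
have acvg : a @ \oo --> 0.
  rewrite -[X in _ --> X](mulr0 y); apply: cvgMr; exact: cvg_harmonic.
pose h n u := (clip (level f u) y - clip (level f u) (a n))%:E.
have lim_int : (\int[mu]_(u in D) h n u)%E @[n --> \oo] -->
    (\int[mu]_(u in D) (limn (h ^~ u)))%E.
  apply: cvg_monotone_convergence; first exact: mD.
  - by move=> n; exact: measurable_clipB.
  - by move=> n u Du; exact: clipB_ge0.
  - move=> u /pos u0 m n mn; rewrite lee_fin lerD2l lerN2; apply: clip_mono => //.
    by rewrite /a ler_pM2l// lef_pV2 ?posrE// ler_nat ltnS.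
have intE n : (\int[mu]_(u in D) h n u)%E = ((phi y - phi (a n)) / 2)%:E.
  exact: clip_integral_derive.
move: lim_int; under eq_fun do rewrite intE; move=> lim_int.
have lim1 : ((phi y - phi (a n)) / 2)%:E @[n --> \oo] --> (phi y / 2)%:E.
  apply: cvg_EFin; first exact: nearW.
  have -> : phi y / 2 = (phi y - phi 0) / 2 by rewrite (F12_derive_0 hf) subr0.
  apply: cvgMl; apply: cvgB; first exact: cvg_cst.
  by apply: (continuous_cvg _ _ acvg); exact: F12_derive_continuous.
have -> : clip_integral 0 y = (\int[mu]_(u in D) (limn (h ^~ u)))%E.
  apply: eq_integral => u /set_mem/pos u0; apply/esym/cvg_lim => //.
  apply: cvg_EFin; first exact: nearW.
  apply: cvgB; first exact: cvg_cst.
  have -> : clip (level f u) 0 = 0 by apply: clip_id; exact: ltW.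
  apply: (@squeeze_cvgr _ _ _ _ (fun=> 0) a) => //; last exact: cvg_cst.
  by apply: nearW => n; rewrite clip_ge0 ?clip_le// ltW.
exact: (cvg_unique _ lim_int lim1).
Qed.

End representation.

Section representation_of_f.
Variables (R : realType) (f : R -> R).
Hypothesis hf : F12 f.
Local Notation phi := (derive1 f).
Local Notation positive := (`]0%E, +oo%E]%classic : set (\bar R)).
Local Notation mu := (@lebesgue_measure R).
Local Notation D := (level f @^-1` positive).
Implicit Types (u x y z a b : R).

Let mD : measurable D. Proof. exact: measurable_pre_positive. Qed.
Let pos u : D u -> (0 < level f u)%E. Proof. exact: pre_positive. Qed.

Lemma integral_clip_level x : 0 <= x ->
  (\int[mu]_(u in D) (clip (level f u) x)%:E)%E = (phi x / 2)%:E.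
Proof.
have clip0 u : D u -> clip (level f u) 0 = 0.
  by move=> /pos u0; apply: clip_id; exact: ltW.
rewrite le_eqVlt => /predU1P[<-|x0].
  rewrite (F12_derive_0 hf) mul0r integral0_eq// => u Du.
  by rewrite clip0.
rewrite -(clip_integral_0 hf x0); apply: eq_integral => u /set_mem Du.
by rewrite clip0// subr0.
Qed.

Let measurable_psi_level x : measurable_fun D (fun u => (psi (level f u) x)%:E).
Proof.
apply: (@eq_measurable_fun _ _ _ _ _ (fun u =>
    (2 * `|x| * clip (level f u) `|x| - clip (level f u) `|x| ^+ 2)%:E)).
  by move=> u /set_mem/pos u0; rewrite psi_clip.
have mc := @measurable_clip_level _ f `|x|.
apply/measurable_EFinP; apply: measurable_funB.
  by apply: measurable_funM; [exact: measurable_cst|exact: mc].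
exact: measurable_funX.
Qed.

Definition psi_integral x y : \bar R :=
  (\int[mu]_(u in D) (psi (level f u) y - psi (level f u) x)%:E)%E.

Let measurable_psiB x y :
  measurable_fun D (fun u => (psi (level f u) y - psi (level f u) x)%:E).
Proof.
by apply/measurable_EFinP; apply: measurable_funB; apply/measurable_EFinP;
  exact: measurable_psi_level.
Qed.

Let psiB_ge0 x y : 0 <= x -> x <= y -> forall u, D u ->
  (0 <= (psi (level f u) y - psi (level f u) x)%:E)%E.
Proof. by move=> x0 xy u /pos u0; rewrite lee_fin subr_ge0 psi_le. Qed.

Let measurable_scaled_clip (c : R) x :
  measurable_fun D (fun u => (c%:E * (clip (level f u) x)%:E)%E).
Proof.
by apply: measurable_funeM; apply/measurable_EFinP; exact: measurable_clip_level.
Qed.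

Let integral_scaled_clip (c : R) x : 0 <= c -> 0 <= x ->
  (\int[mu]_(u in D) (c%:E * (clip (level f u) x)%:E))%E = (c * (phi x / 2))%:E.
Proof.
move=> c0 x0; rewrite ge0_integralZl//.
- by rewrite integral_clip_level.
- by apply/measurable_EFinP; exact: measurable_clip_level.
- by move=> u /pos u0; rewrite lee_fin clip_ge0.
Qed.

Lemma psi_integralD x y z : 0 <= x -> x <= y -> y <= z ->
  psi_integral x z = (psi_integral x y + psi_integral y z)%E.
Proof.
move=> x0 xy yz; have y0 := le_trans x0 xy.
rewrite /psi_integral -ge0_integralD//; try exact: psiB_ge0; try exact: measurable_psiB.
by apply: eq_integral => u _; rewrite -EFinD; congr EFin; ring.
Qed.

Lemma psi_integral_ge x y : 0 <= x -> x <= y ->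
  (((y - x) * phi x)%:E <= psi_integral x y)%E.
Proof.
move=> x0 xy; have c0 : 0 <= 2 * (y - x) by rewrite mulr_ge0// subr_ge0.
have -> : (y - x) * phi x = (2 * (y - x)) * (phi x / 2) by field.
rewrite -integral_scaled_clip//; apply: ge0_le_integral; first exact: mD.
- by move=> u /pos u0; rewrite mule_ge0// lee_fin clip_ge0.
- exact: measurable_scaled_clip.
- exact: measurable_psiB.
move=> u /pos u0; rewrite -EFinM lee_fin.
by rewrite mulrAC; exact: psi_increment_ge.
Qed.

Lemma psi_integral_le x y : 0 <= x -> x <= y ->
  (psi_integral x y <= ((y - x) * phi y)%:E)%E.
Proof.
move=> x0 xy; have c0 : 0 <= 2 * (y - x) by rewrite mulr_ge0// subr_ge0.
have -> : (y - x) * phi y = (2 * (y - x)) * (phi y / 2) by field.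
rewrite -integral_scaled_clip ?(le_trans x0 xy)//; apply: ge0_le_integral; first exact: mD.
- exact: psiB_ge0.
- exact: measurable_psiB.
- exact: measurable_scaled_clip.
move=> u /pos u0; rewrite -EFinM lee_fin.
by rewrite mulrAC; exact: psi_increment_le.
Qed.

(** The bounds on the increments of the integral are those that the mean value
    theorem gives for f. *)
Lemma psi_integral_0 y : 0 <= y -> psi_integral 0 y = (f y)%:E.
Proof.
move=> y0.
have fin z : 0 <= z -> psi_integral 0 z \is a fin_num.
  move=> z0; rewrite ge0_fin_numE.
    exact: le_lt_trans (psi_integral_le (lexx 0) z0) (ltry _).
  by apply: integral_ge0 => u; exact: psiB_ge0.
pose E z := fine (psi_integral 0 z) - f z.
suff : E y = E 0.
  rewrite /E; have -> : psi_integral 0 0 = 0%E.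
    by rewrite /psi_integral integral0_eq// => u _; rewrite subrr.
  rewrite (F12_0 hf) subr0 /= => /eqP; rewrite subr_eq0 => /eqP <-.
  by rewrite fineK ?fin.
apply: (@constant_of_increment_le _ E (fun z => - phi z) 0 y y0) => a b a0 ab yb.
have := psi_integral_le a0 ab; have := psi_integral_ge a0 ab.
have [h3 h4] := F12_increment hf a0 ab.
have e := psi_integralD (lexx 0) a0 ab.
have fa := fin _ a0; have fb := fin _ (le_trans a0 ab).
have -> : psi_integral a b = (fine (psi_integral 0 b) - fine (psi_integral 0 a))%:E.
  move: e fb; rewrite -(fineK fa); case: (psi_integral a b) => [r| |] -> //= _.
  by congr EFin; lra.
rewrite !lee_fin => h1 h2; rewrite /E.
rewrite ler_norml; move: h1 h2 h3 h4; clear.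
move: (fine _) (fine _) (phi a) (phi b) (f a) (f b) => *.
by apply/andP; split; lra.
Qed.

(** The integral of min(t, 1) is half of phi(1), hence finite. *)
Lemma exists_representation : exists m, represents f m.
Proof.
have [m m0 mE] := level_measure f; exists m; split.
- exact: m0.
- rewrite mE; last 2 first.
  + by apply: measurable_funTS; apply: measurable_mine.
  + by move=> t; rewrite /= in_itv/= le_min lee_fin ler01 andbT => /andP[/ltW].
  have -> : (\int[mu]_(u in D) mine (level f u) 1 =
      \int[mu]_(u in D) (clip (level f u) 1%R)%:E)%E.
    by apply: eq_integral => u /set_mem/pos u0; rewrite EFin_clip.
  by rewrite integral_clip_level// ltry.
- move=> x; rewrite mE; last 2 first.
  + exact: measurable_psi.
  + by move=> t; rewrite /= in_itv/= lee_fin => /andP[t0 _]; exact: psi_ge0.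
  have -> : f x = f `|x| by case: (ger0P x) => // _; rewrite (F12_even hf).
  rewrite -psi_integral_0//; apply: eq_integral => u /set_mem/pos u0.
  by rewrite psi_norm psi_0// subr0.
Qed.

Lemma represents_gamma : represents f (gamma f).
Proof. by have [m fm] := exists_representation; exact: (@xgetI {classic {measure set (\bar R) -> \bar R}} _ (represents f) m fm). Qed.

End representation_of_f.

(** * Linearity of the derivative up to s *)

Section linear_derivative.
Variables (R : realType) (f : R -> R).
Hypothesis hf : F12 f.
Local Notation phi := (derive1 f).
Implicit Types (s x y : R).

(** The increments of f and of its quadratic candidate have the same bounds,
    (y - x) phi(x) and (y - x) phi(y). *)
Lemma quadratic_of_linear s x : 0 < s -> linear_upto phi s -> 0 <= x <= s ->
  2 * s * f x = x ^+ 2 * phi s.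
Proof.
move=> s0 lin /andP[x0 xs]; pose k := phi s / s.
have phiE y : 0 <= y <= s -> phi y = y * k.
  by move=> /lin e; rewrite /k mulrA -e [s * _]mulrC mulfK// gt_eqF.
pose E y := f y - k / 2 * y ^+ 2.
have : E x = E 0.
  apply: (@constant_of_increment_le _ E (fun y => - (y * k)) 0 x x0) => a b a0 ab bx.
  have pa : phi a = a * k by apply: phiE; apply/andP; split; lra.
  have pb : phi b = b * k by apply: phiE; apply/andP; split; lra.
  have := F12_increment hf a0 ab; rewrite pa pb => -[h1 h2].
  rewrite /E ler_norml.
  have : (b - a) * (a * k) <= k / 2 * (b ^+ 2 - a ^+ 2) <= (b - a) * (b * k).
    have k0 : 0 <= k by rewrite divr_ge0 ?(F12_derive_ge0 hf) ?ltW.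
    have : 0 <= k / 2 * (b - a) ^+ 2 by apply: mulr_ge0; [lra|exact: sqr_ge0].
    by move=> ?; apply/andP; split; lra.
  by move=> /andP[h3 h4]; apply/andP; split; lra.
rewrite /E (F12_0 hf) expr0n/= mulr0 subr0 => /eqP; rewrite subr_eq0 => /eqP ->.
by rewrite /k; field; rewrite gt_eqF.
Qed.

(** The increment of f over [x, y] lies between (y - x) phi(x) and (y - x) phi(y),
    so k (x + y) lies between phi(x) and phi(y); let y decrease to x, and x
    increase to y = s. *)
Lemma linear_of_quadratic s : 0 < s ->
  (forall x, `|x| <= s -> s ^+ 2 * f x = x ^+ 2 * f s) -> linear_upto phi s.
Proof.
move=> s0 quad; pose k := f s / s ^+ 2.
have fE x : 0 <= x <= s -> f x = k * x ^+ 2.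
  move=> /andP[x0 xs]; have := quad x; rewrite ger0_norm// => /(_ xs) e.
  apply: (@mulfI _ (s ^+ 2)); first by rewrite expf_neq0// gt_eqF.
  by rewrite e /k; field; rewrite gt_eqF.
have chords x y : 0 <= x -> x < y -> y <= s -> phi x <= k * (x + y) <= phi y.
  move=> x0 xy ys; have [] := F12_increment hf x0 (ltW xy).
  rewrite !fE ?x0 ?(le_trans x0 (ltW xy))//; last by rewrite (le_trans (ltW xy)).
  have -> : k * y ^+ 2 - k * x ^+ 2 = (y - x) * (k * (x + y)) by ring.
  by rewrite !ler_pM2l ?subr_gt0// => -> ->.
have cvg_chord x : k * (x + y) @[y --> x] --> k * (x + x).
  by apply: cvgMr; apply: cvgD; [exact: cvg_cst|exact: cvg_id].
have upper x : 0 <= x -> x < s -> phi x <= k * (x + x).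
  move=> x0 xs; apply: (@cvgr_to_ge _ (x^'+) _ _ (fun y => k * (x + y))).
    by apply: cvg_at_right_filter; exact: cvg_chord.
  near=> y; have xy : x < y by near: y; exact: nbhs_right_gt.
  have ys : y < s by near: y; exact: nbhs_right_lt.
  by have /andP[] := chords x y x0 xy (ltW ys).
have lower : k * (s + s) <= phi s.
  apply: (@cvgr_to_le _ (s^'-) _ _ (fun y => k * (s + y))).
    by apply: cvg_at_left_filter; exact: cvg_chord.
  near=> y; have ys : y < s by near: y; exact: nbhs_left_lt.
  have y0 : 0 < y by near: y; exact: nbhs_left_gt.
  by have /andP[_] := chords y s (ltW y0) ys (lexx s); rewrite addrC.
move=> x /andP[x0]; rewrite le_eqVlt => /predU1P[->//|xs].
apply/eqP; rewrite eq_le.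
rewrite (origin_slope (F12_derive_concave hf) (F12_derive_0 hf) x0 (ltW xs)) andbT.
have h1 : s * phi x <= s * (k * (x + x)) by rewrite ler_pM2l// upper.
have h2 : x * (k * (s + s)) <= x * phi s by rewrite ler_wpM2l.
lra.
Unshelve. all: by end_near. Qed.

End linear_derivative.

(** * The threshold and the constant *)

Section threshold.
Variables (R : realType) (f : R -> R).
Hypothesis hf : F12 f.
Local Notation phi := (derive1 f).
Implicit Types (s x y : R).

Lemma le_s_iff_linear s : 0 < s -> (s%:E <= s_ f)%E <-> linear_upto phi s.
Proof.
move=> s0; have rep := represents_gamma hf; split.
  move=> /null_below_supp/(quadratic_of_null rep s0).
  exact: linear_of_quadratic.
move=> lin; apply: ge_supp_of_null; apply: (null_of_quadratic rep s0).
have h1 := @quadratic_of_linear _ _ hf s (s / 2) s0 lin ltac:(lra).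
have h2 := @quadratic_of_linear _ _ hf s s s0 lin ltac:(lra).
apply: (@mulfI _ (2 * s)); first by rewrite mulf_neq0// gt_eqF.
by rewrite h2 mulrCA h1; field.
Qed.

Lemma nonlinear_of_gt_s s : (s_ f < s%:E)%E -> 0 < s /\ ~ linear_upto phi s.
Proof.
move=> sf; have s0 : 0 < s.
  rewrite -lte_fin; apply: le_lt_trans sf.
  by apply: le_ereal_inf_tmp => t [/ltW].
by split=> // /(le_s_iff_linear s0).2; rewrite leNgt sf.
Qed.

Lemma L_of_linear s x : 0 < s -> linear_upto phi s -> 0 < x < s -> L f s x = f s.
Proof.
move=> s0 lin /andP[x0 xs]; rewrite (LE hf).
have h1 := @quadratic_of_linear _ _ hf s (s - x) s0 lin ltac:(lra).
have h2 := @quadratic_of_linear _ _ hf s x s0 lin ltac:(lra).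
have h3 := @quadratic_of_linear _ _ hf s s s0 lin ltac:(lra).
have h4 := lin x ltac:(lra).
apply: (@mulfI _ (2 * s)); first by rewrite mulf_neq0// gt_eqF.
rewrite mulrDr mulrBr h1 h2 h3.
have -> : 2 * s * (s * phi x) = 2 * s * (x * phi s) by rewrite h4.
ring.
Qed.

Lemma exists_L_gt s : 0 < s -> ~ linear_upto phi s ->
  exists2 x, 0 < x < s & f s < L f s x.
Proof.
move=> s0 nl.
have [x /andP[x0 xs] lt] := origin_slope_reflection_lt (F12_derive_concave hf)
  (F12_derive_0 hf) (F12_derive_mono hf) s0 nl.
exists x; first by apply/andP; split; lra.
have := L_ge_left hf (ltW x0) (ltW xs).
by rewrite -subr_gt0; apply: lt_le_trans; rewrite subr_gt0.
Qed.

(** Otherwise phi would be linear on every [0, s], and f would be a multiple of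
    x^2. *)
Lemma s_lty : f <> (fun=> 0) ->
  (forall c : R, 0 < c -> f <> (fun x => c * psi +oo%E x)) -> (s_ f < +oo)%E.
Proof.
move=> f0 fpsi; rewrite ltey; apply/eqP => sf.
have lin s : 0 < s -> linear_upto phi s.
  by move=> s0; apply/(le_s_iff_linear s0); rewrite sf leey.
apply: (fpsi (f 1)); first exact: (F12_gt0 hf).
have f_quad x : 0 < x -> f x = f 1 * x ^+ 2.
  move=> x0; pose s := 1 + x.
  have s0 : 0 < s by rewrite /s; lra.
  have h1 := @quadratic_of_linear _ _ hf s 1 s0 (lin _ s0) ltac:(rewrite /s; lra).
  have h2 := @quadratic_of_linear _ _ hf s x s0 (lin _ s0) ltac:(rewrite /s; lra).
  apply: (@mulfI _ (2 * s)); first by rewrite mulf_neq0// gt_eqF.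
  by rewrite mulrA h1 h2; ring.
apply/funext => x /=; have [x0|x0|<-] := ltgtP 0 x; first exact: f_quad.
  by rewrite -(F12_even hf) f_quad ?oppr_gt0// sqrrN.
by rewrite (F12_0 hf) expr0n/= mulr0.
Qed.

Section constant.
Hypothesis f0 : f <> (fun=> 0).
Hypothesis fpsi : forall c : R, 0 < c -> f <> (fun x => c * psi +oo%E x).

Lemma exists_gt_s : exists s, (s_ f < s%:E)%E.
Proof.
have := s_lty f0 fpsi.
case: (s_ f) => [r|//|]; last by exists 0; rewrite ltNyr.
by exists (r + 1); rewrite lte_fin ltrDl.
Qed.

(** A pair (s, x) with s <= s_f gives the value 1, which is exceeded by the value
    at the peak for any s beyond s_f. *)
Lemma C_of_peaks (xf : R -> R) :
  (forall s, (s_ f < s%:E)%E -> is_peak f s (xf s)) ->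
  C_ f = ereal_sup [set (L f s (xf s) / f s)%:E | s in [set s : R | (s_ f < s%:E)%E]].
Proof.
move=> peaks; apply/eqP; rewrite eq_le; apply/andP; split.
  apply: ge_ereal_sup => _ [s [x [/andP[x0 xs] ->]]].
  have s0 : 0 < s by exact: lt_trans xs.
  have [sf|sf] := leP s%:E (s_ f).
    have [s1 s1f] := exists_gt_s; have [s10 nl] := nonlinear_of_gt_s s1f.
    apply: (@le_trans _ _ (L f s1 (xf s1) / f s1)%:E); last first.
      by apply: ereal_sup_ubound; exists s1.
    have lin := (le_s_iff_linear s0).1 sf.
    rewrite L_of_linear ?x0// divff ?gt_eqF ?(F12_gt0 hf)// lee_fin ler_pdivlMr ?(F12_gt0 hf)// mul1r.
    have [y /andP[y0 ys] /ltW/le_trans] := exists_L_gt s10 nl; apply.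
    by apply: (peak_max (peaks _ s1f)).2; exists y => //=; rewrite in_itv/= y0.
  apply: (@le_trans _ _ (L f s (xf s) / f s)%:E); last first.
    by apply: ereal_sup_ubound; exists s.
  rewrite lee_fin ler_pM2r ?invr_gt0 ?(F12_gt0 hf)//.
  by apply: (peak_max (peaks _ sf)).2; exists x => //=; rewrite in_itv/= x0.
apply: ge_ereal_sup => _ [s /= sf <-]; apply: ereal_sup_ubound.
by exists s, (xf s); split=> //; have [] := peaks s sf.
Qed.

Lemma C_gt1 : (1 < C_ f)%E.
Proof.
have [s sf] := exists_gt_s; have [s0 nl] := nonlinear_of_gt_s sf.
have [x xs Lx] := exists_L_gt s0 nl.
apply: (@lt_le_trans _ _ (L f s x / f s)%:E).
  by rewrite lte_fin ltr_pdivlMr ?mul1r// (F12_gt0 hf).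
by apply: ereal_sup_ubound; exists s, x.
Qed.

End constant.
End threshold.

Theorem proposition1p4 (R : realType) (f : R -> R)
    (hf : F12 f)
    (hf0 : f <> (fun=> 0))
    (hfpsi : forall c : R, 0 < c -> f <> (fun x => c * psi +oo%E x)) :
  (0 <= s_ f < +oo)%E /\
  (forall s : R, 0 < s -> (s%:E <= s_ f)%E ->
     forall x : R, 0 < x < s -> L f s x = f s) /\
  (forall s : R, (s_ f < s%:E)%E ->
     (exists l : \bar R, (L' f s x)%:E @[x --> (0:R)^'+] --> l /\ (0 < l)%E) /\
     (exists l : R, L' f s x @[x --> s^'-] --> l /\ l < 0)) /\
  (forall s : R, 0 < s -> exists x : R, is_peak f s x) /\
  (exists m : R -> R,
     (forall s : R, (s_ f < s%:E)%E -> is_max (L f s @` `]0, s[) (m s)) /\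
     C_ f = ereal_sup [set (m s / f s)%:E | s in [set s : R | (s_ f < s%:E)%E]]) /\
  (forall xf : R -> R, (forall s : R, 0 < s -> is_peak f s (xf s)) ->
     C_ f = ereal_sup
       [set (L f s (xf s) / f s)%:E | s in [set s : R | (s_ f < s%:E)%E]]) /\
  (1 < C_ f)%E.
Proof.
have gt_s0 s : (s_ f < s%:E)%E -> 0 < s by move=> /(nonlinear_of_gt_s hf)[].
split.
  apply/andP; split; last exact: s_lty.
  by apply: le_ereal_inf_tmp => t [/ltW].
split; first by move=> s s0 /(le_s_iff_linear hf s0) lin x; exact: L_of_linear.
split.
  move=> s /(nonlinear_of_gt_s hf)[s0 nl]; split.
    exact: L'_right_limit_pos.
  exact: L'_left_limit_neg.
split; first exact: exists_peak.
split.
  have peak s : exists x, 0 < s -> is_peak f s x.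
    have [/(exists_peak hf)[x px]|s0] := ltP 0 s; first by exists x.
    by exists 0 => s1.
  have [xf peaks] := choice peak.
  exists (fun s => L f s (xf s)); split.
    by move=> s /gt_s0/peaks; exact: peak_max.
  by apply: C_of_peaks => // s /gt_s0; exact: peaks.
split; last exact: C_gt1.
by move=> xf peaks; apply: C_of_peaks => // s /gt_s0; exact: peaks.
Qed.
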